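(* Let $r_0, r_1, \ldots, r_{n-1} \ge 0$ with $\sum_{j=0}^{n-1} r_j = 1$. Suppose that $P$ is an $n \times n$ partial stochastic matrix where row $n$ has been specified as $p_{n,j}=r_{n-j}$, $j=1, \ldots, n$, and all remaining entries are unspecified. Then $$m(P) = \min \left\{ \frac{n-2}{2}+\frac{1}{1-r_0},\; n-1-\frac{\sum_{j=1}^{n-1}j(j+1) r_{\sigma(j)}}{2\left(1+\sum_{j=1}^{n-1}j r_{\sigma(j)}\right)} \right\},$$ where the minimum is taken over all permutations $\sigma$ of $\{1, \ldots, n-1\}$ (that is, $m(P)$ is the smallest among the first quantity and all the quantities of the second form as $\sigma$ ranges over the permutations of $\{1,\ldots,n-1\}$).
   Context: A stochastic matrix is a square, entrywise nonnegative real matrix each of whose row sums equals $1$. A partial matrix is one in which some entries are specified and the others are not; a completion is obtained by assigning values to all unspecified entries. A partial stochastic matrix is a partial matrix $P$ such that: (i) $P$ is square; (ii) all specified entries are nonnegative; (iii) in each row the sum of the specified entries is at most $1$, and it equals $1$ for any fully specified row; (iv) any row whose specified entries sum to $1$ is fully specified; (v) any row that is not fully specified contains at least two unspecified entries. $SC(P)$ denotes the set of all completions of $P$ that are stochastic matrices. The directed graph of an $n\times n$ stochastic matrix $T=[t_{i,j}]$ has vertices $1,\ldots,n$ and an arc $i\to j$ iff $t_{i,j}>0$. An index $j$ is essential if whenever there is a walk from $j$ to $k$ there is also a walk from $k$ to $j$. The essential indices are partitioned into essential classes: subsets within which any index can be reached from any other, and from which no index outside can be reached. $T$ has a single essential class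 if and only if $1$ is an algebraically simple eigenvalue of $T$. For a stochastic matrix $T$ of order $n$ with a single essential class and eigenvalues $1=\lambda_1,\lambda_2,\ldots,\lambda_n$ (with algebraic multiplicity), Kemeny's constant is $\mathcal{K}(T)=\sum_{j=2}^n \frac{1}{1-\lambda_j}$. If some stochastic completion of $P$ has a single essential class, $m(P)=\inf\{\mathcal{K}(T) : T\in SC(P),\ T \text{ has a single essential class}\}$. *)

(* Defs.v *)
From HB Require Import structures.
From mathcomp Require Export all_boot all_order all_algebra all_fingroup.
From mathcomp Require Export complex.
From mathcomp Require Export classical_sets reals ereal.

Set Implicit Arguments.
Unset Strict Implicit.
Unset Printing Implicit Defensive.

Export Order.TTheory GRing.Theory Num.Theory.

Local Open Scope ring_scope.

Section StochasticMatrices.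
Variables (R : realType) (n : nat).
Implicit Types (T : 'M[R]_n) (P : 'M[option R]_n) (C : {set 'I_n}).

Definition stochastic T : Prop :=
  (forall i j, 0 <= T i j) /\ (forall i, \sum_j T i j = 1).

(* A partial matrix has entries in option R, None being an unspecified entry. *)
Definition fully_specified P (i : 'I_n) : Prop := forall j, P i j != None.

Definition specified_sum P (i : 'I_n) : R := \sum_j odflt 0 (P i j).

Definition partial_stochastic P : Prop :=
  [/\ forall i j x, P i j = Some x -> 0 <= x,
      forall i, specified_sum P i <= 1,
      forall i, fully_specified P i -> specified_sum P i = 1,
      forall i, specified_sum P i = 1 -> fully_specified P i
    & forall i, ~ fully_specified P i ->
        (2 <= #|[set j | P i j == None]|)%N].

Definition completion P T : Prop :=
  forall i j x, P i j = Some x -> T i j = x.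

Definition SC P : set 'M[R]_n := [set T | stochastic T /\ completion P T]%classic.

Definition arc T : rel 'I_n := fun i j => 0 < T i j.

Definition essential T (j : 'I_n) : Prop :=
  forall k, connect (arc T) j k -> connect (arc T) k j.

Definition essential_class T C : Prop :=
  [/\ C != finset.set0,
      forall i, i \in C -> essential T i,
      forall i j, i \in C -> j \in C -> connect (arc T) i j
    & forall i j, i \in C -> j \notin C -> ~~ connect (arc T) i j].

Definition single_essential_class T : Prop :=
  exists! C : {set 'I_n}, essential_class T C.

(* The complex eigenvalues of T, listed with algebraic multiplicity. *)
Definition eigenvalues T : seq R[i] :=
  sval (closed_field_poly_normal (char_poly (map_mx (real_complex R) T))).

Lemma eigenvaluesE T :
  char_poly (map_mx (real_complex R) T)
    = \prod_(z <- eigenvalues T) ('X - z%:P).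
Proof.
rewrite /eigenvalues; case: closed_field_poly_normal => s /= {1}->.
by rewrite (monicP (char_poly_monic _)) scale1r.
Qed.

(* rem removes a single occurrence of the eigenvalue 1. *)
Definition kemenyC T : R[i] :=
  \sum_(z <- rem 1 (eigenvalues T)) (1 - z)^-1.

(* The non-real eigenvalues of a real matrix come in conjugate pairs, so the
   sum is real. *)
Lemma kemenyC_real T : complex.Im (kemenyC T) = 0.
Proof.
have cjK (z : R[i]) : (z^*)^*%C = z by exact: conjcK.
have perm_eig : perm_eq [seq z^*%C | z <- eigenvalues T] (eigenvalues T).
  apply: prod_XsubC_eq; rewrite big_map -eigenvaluesE.
  transitivity (map_poly (@conjc R) (char_poly (map_mx (real_complex R) T))).
    rewrite eigenvaluesE rmorph_prod; apply: eq_bigr => z _.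
    by rewrite rmorphB /= map_polyX map_polyC.
  rewrite map_char_poly -map_mx_comp; congr char_poly.
  by apply/matrixP => i j; rewrite !mxE; exact: conjc_real.
have perm_rem1 : perm_eq [seq z^*%C | z <- rem 1 (eigenvalues T)]
                        (rem 1 (eigenvalues T)).
  have rem_map : [seq z^*%C | z <- rem 1 (eigenvalues T)]
      = rem 1 [seq z^*%C | z <- eigenvalues T].
    elim: (eigenvalues T) => //= z s IHs.
    rewrite -(inj_eq (can_inj cjK)) rmorph1.
    by case: eqP => //= _; rewrite IHs.
  rewrite rem_map; have [e1|ne1] := boolP (1 \in eigenvalues T); last first.
    by rewrite !rem_id // (perm_mem perm_eig).
  rewrite -(perm_cons 1) -(permPl (perm_to_rem _)) ?(perm_mem perm_eig) //.
  by rewrite (permPl perm_eig) perm_to_rem.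
have kC : (kemenyC T)^*%C = kemenyC T.
  rewrite /kemenyC -[RHS](perm_big _ perm_rem1) big_map rmorph_sum.
  by apply: eq_bigr => z _; rewrite fmorphV rmorphB rmorph1.
move: kC; case: (kemenyC T) => a b [] /eqP.
by rewrite eq_sym -subr_eq0 opprK -mulr2n mulrn_eq0 /= => /eqP.
Qed.

Definition kemeny T : R := complex.Re (kemenyC T).

(* The infimum is taken in \bar R: it is +oo exactly when no stochastic
   completion of P has a single essential class, i.e. when m(P) is undefined. *)
Definition kemeny_inf P : \bar R :=
  ereal_inf [set (kemeny T)%:E | T in
    [set T | SC P T /\ single_essential_class T]]%classic.

End StochasticMatrices.

(* Main.v *)
Require Import Defs.
From mathcomp Require Import ring lra zify.

(** Write Kemeny's constant as q'(1)/q(1), where the characteristic polynomial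
    of T is (X - 1) q(X).  Expanding det(X - T) around X = 1 gives
    q(1) = F_1 and q'(1) = F_2, where F_k is the sum of the principal minors of
    I - T obtained by deleting k indices (kemeny_forest).  When T is
    stochastic, F_k is a sum over all functions f from the vertices to
    themselves, weighted by prod_i T(i, f i), of the number of k-sets that
    every f-orbit meets (forest_sumE, the Markov chain tree theorem).  In
    particular F_1 > 0 exactly when T has a single essential class
    (single_essential_class_gt0).

    Averaging over the image of the last vertex z, whose row rho is prescribed,
    turns F_2 / F_1 into a mediant, over functions f, of the ratios
    root_sum 2 f / root_sum 1 f; these depend only on f away from z and are
    Kemeny's constants of the matrices with row z equal to rho and the other
    rows given by f.  So only these finitely many matrices compete
    (kemeny_ge, kemeny_redirect_mx).

    If all f-orbits reach z, then f is a tree rooted at z, and when e + 1 is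
    the depth of a vertex other than z the ratio is
    N - sum (e+1)(e+2) rho / (2 (1 + sum (e+1) rho)), with N = n - 1.  While
    the tree is not a path, two vertices share a level, and moving one of them
    below all the others does not increase the ratio (level_path); a path is a
    permutation of the N other vertices.  If instead some orbit avoids z, then
    F_1 comes from a single cycle, of length k <= N, avoiding z; the ratio is
    smallest when k = N, which gives (n-2)/2 + 1/(1 - r_0) (cycle_bound).  Both
    kinds of bounds are attained (path_attained, cycle_attained). *)

Set Implicit Arguments.
Unset Strict Implicit.
Unset Printing Implicit Defensive.

Local Open Scope ring_scope.

(** * Principal minors of the Laplacian and Kemeny's constant *)

(** Replacing the rows of I - T indexed by S by those of the identity makes
    its determinant the principal minor of I - T on the complement of S, with
    no change of matrix size. *)
Definition grounded (R : nzRingType) n (T : 'M[R]_n) (S : {set 'I_n}) : 'M[R]_n :=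
  \matrix_(i, j) (if i \in S then (i == j)%:R else (i == j)%:R - T i j).

Lemma det_add_rows (R : comNzRingType) n (A B : 'M[R]_n) :
  \det (A + B) =
    \sum_(S : {set 'I_n}) \det (\matrix_(i, j) if i \in S then A i j else B i j).
Proof.
rewrite [LHS]/determinant [RHS]exchange_big /=; apply: eq_bigr => s _.
rewrite -mulr_sumr; congr (_ * _).
under eq_bigr do rewrite mxE.
by rewrite bigA_distr; apply: eq_bigr => S _; apply: eq_bigr => i _; rewrite mxE.
Qed.

(** X - T = (X - 1) + (I - T): each row of the determinant is a sum of two
    rows, and S collects the rows for which (X - 1) is chosen. *)
Lemma char_poly_grounded (R : comNzRingType) n (T : 'M[R]_n) :
  char_poly T =
    \sum_(S : {set 'I_n}) (\det (grounded T S))%:P * ('X - 1%:P) ^+ #|S|.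
Proof.
have -> : char_poly T = \det (('X - 1%:P)%:M + map_mx polyC (1%:M - T)).
  congr (\det _); apply/matrixP => i j; rewrite !mxE.
  by case: (i == j); rewrite ?mulr1n ?mulr0n rmorphB /= ?polyC1 ?polyC0; ring.
rewrite det_add_rows; apply: eq_bigr => S _.
pose d : 'rV[{poly R}]_n := \row_i if i \in S then 'X - 1%:P else 1.
transitivity (\det (diag_mx d *m map_mx polyC (grounded T S))).
  congr (\det _); rewrite mul_diag_mx; apply/matrixP => i j; rewrite !mxE.
  case: ifP => _; last by rewrite mul1r.
  by case: (i == j); rewrite ?polyC1 ?polyC0 ?mulr1 ?mulr0.
rewrite det_mulmx det_diag det_map_mx mulrC; congr (_ * _).
under eq_bigr do rewrite mxE.
by rewrite -big_mkcond /= prodr_const.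
Qed.

Definition forest_sum (R : nzRingType) n k (T : 'M[R]_n) : R :=
  \sum_(S : {set 'I_n} | #|S| == k) \det (grounded T S).

Lemma char_poly_at1 (R : comNzRingType) n (T : 'M[R]_n) :
  (char_poly T).[1] = forest_sum 0 T.
Proof.
rewrite char_poly_grounded horner_sum /forest_sum [RHS]big_mkcond.
apply: eq_bigr => S _; rewrite !hornerE subrr.
by case: (#|S|) => [|k]; rewrite ?expr0 ?mulr1 ?exprS ?mul0r ?mulr0.
Qed.

Lemma deriv_char_poly_at1 (R : comNzRingType) n (T : 'M[R]_n) :
  (char_poly T)^`().[1] = forest_sum 1 T.
Proof.
rewrite char_poly_grounded raddf_sum horner_sum /forest_sum [RHS]big_mkcond.
apply: eq_bigr => S _.
rewrite /= deriv_mulC deriv_exp derivXsubC mul1r.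
rewrite !hornerE /= ?hornerMn ?horner_exp ?hornerXsubC subrr.
case: (#|S|) => [|[|k]]; rewrite ?mulr0n ?mulr0 //= ?expr0 ?mulr1 //.
by rewrite exprS mul0r mul0rn mulr0.
Qed.

Lemma deriv2_char_poly_at1 (R : comNzRingType) n (T : 'M[R]_n) :
  (char_poly T)^`()^`().[1] = forest_sum 2 T *+ 2.
Proof.
rewrite char_poly_grounded !raddf_sum horner_sum /forest_sum -sumrMnl.
rewrite [RHS]big_mkcond; apply: eq_bigr => S _.
rewrite /= deriv_mulC deriv_exp derivXsubC mul1r deriv_mulC.
rewrite derivMn deriv_exp derivXsubC.
rewrite mul1r !hornerE /= ?hornerMn ?horner_exp ?hornerXsubC subrr.
case: (#|S|) => [|[|[|k]]]; rewrite /= ?mulr0n ?mul0rn ?mulr0 //= ?mulr1n.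
  by rewrite expr0 mulr_natr.
by rewrite exprS mul0r !mul0rn mulr0.
Qed.

Lemma deriv_prod_XsubC (F : fieldType) (s : seq F) (a : F) :
  a \notin s ->
  (\prod_(z <- s) ('X - z%:P))^`().[a] =
    (\prod_(z <- s) ('X - z%:P)).[a] * \sum_(z <- s) (a - z)^-1.
Proof.
elim: s => [|z s IHs]; first by rewrite !big_nil derivC horner0 mulr0.
rewrite inE negb_or => /andP[az /IHs {}IHs].
rewrite !big_cons derivM derivXsubC mul1r !hornerE IHs.
have : a - z != 0 by rewrite subr_eq0.
by move=> nz; field.
Qed.

(** The logarithmic derivative at 1 of q(X) = char_poly T / (X - 1) is the
    sum of the 1 / (1 - z) over the eigenvalues z left once 1 is removed. *)
Lemma kemeny_forest (R : realType) n (T : 'M[R]_n) :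
  forest_sum 0 T = 0 -> forest_sum 1 T != 0 ->
  kemeny T = forest_sum 2 T / forest_sum 1 T.
Proof.
move=> F0 F1.
pose c : {rmorphism R -> R[i]} := real_complex R.
have pE : map_poly c (char_poly T) = \prod_(z <- eigenvalues T) ('X - z%:P).
  by rewrite -eigenvaluesE -map_char_poly.
have hE (p : {poly R}) : (map_poly c p).[1] = c p.[1].
  by rewrite -(rmorph1 c) horner_map.
have e1 : 1 \in eigenvalues T.
  by rewrite -root_prod_XsubC -pE /root hE char_poly_at1 F0 rmorph0.
pose q : {poly R[i]} := \prod_(z <- rem 1 (eigenvalues T)) ('X - z%:P).
have pq : map_poly c (char_poly T) = ('X - 1%:P) * q.
  by rewrite pE (big_rem _ e1).
have q1 : q.[1] = c (forest_sum 1 T).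
  rewrite -deriv_char_poly_at1 -hE -deriv_map pq derivM derivXsubC mul1r !hornerE.
  by rewrite subrr mul0r addr0.
have q2 : q^`().[1] = c (forest_sum 2 T).
  have /eqP : q^`().[1] *+ 2 = c (forest_sum 2 T) *+ 2.
    rewrite -rmorphMn -deriv2_char_poly_at1 -hE -!deriv_map pq derivM derivXsubC mul1r.
    rewrite derivD derivM derivXsubC mul1r !hornerE.
    by rewrite /= subrr mul0r addr0 mulr2n.
  by rewrite -subr_eq0 -mulrnBl mulrn_eq0 /= subr_eq0 => /eqP.
have q1n : 1 \notin rem 1 (eigenvalues T).
  by rewrite -root_prod_XsubC -/q /root q1 fmorph_eq0.
have cF1 : c (forest_sum 1 T) != 0 by rewrite fmorph_eq0.
have : kemenyC T = c (forest_sum 2 T / forest_sum 1 T).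
  rewrite fmorph_div -q2 (deriv_prod_XsubC q1n) -/q q1 mulrAC mulfV ?mul1r //.
by rewrite /kemeny => ->.
Qed.

(** * Rooted sets of a finite dynamical system *)

Section RootedSets.
Variable V : finType.
Implicit Types (f : {ffun V -> V}) (S : {set V}).

Definition rooted f S := [forall v, exists w in S, fconnect f v w].

Definition rooted_count k f := #|[set S : {set V} | (#|S| == k) && rooted f S]|.

(** The vertices that every orbit reaches: the unique cycle of f if there is
    only one, and the empty set otherwise. *)
Definition attractor f := [set c | [forall v, fconnect f v c]].

Lemma fconnect_stable (f : V -> V) (Q : pred V) x y :
  Q x -> (forall v, Q v -> Q (f v)) -> fconnect f x y -> Q y.
Proof.
move=> Qx Qf /iter_findex <-.
by elim: (findex f x y) => //= m; apply: Qf.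
Qed.

Lemma attractorP f c :
  reflect (forall v, fconnect f v c) (c \in attractor f).
Proof. by rewrite inE; apply: forallP. Qed.

Lemma rooted1E f c : rooted f [set c] = (c \in attractor f).
Proof.
rewrite inE; apply: eq_forallb => v.
apply/exists_inP/idP => [[w /set1P ->] //|vc]; by exists c; rewrite ?set11.
Qed.

Lemma rooted_count0 f : (0 < #|V|)%N -> rooted_count 0 f = 0%N.
Proof.
case/card_gt0P => x _; apply/eqP; rewrite cards_eq0; apply/eqP/setP => S.
rewrite !inE cards_eq0; apply/negbTE/andP => -[/eqP -> /forallP /(_ x)].
by case/exists_inP => w; rewrite inE.
Qed.

Lemma rooted_count1 f : rooted_count 1 f = #|attractor f|.
Proof.
rewrite -(card_imset _ (@set1_inj V)); apply: eq_card => S; rewrite !inE.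
apply/andP/imsetP => [[/cards1P[c ->]]|[c cC ->]].
  by rewrite rooted1E => cC; exists c.
by rewrite cards1 rooted1E.
Qed.

(** Once an attracting vertex c exists, the orbit of c stays among attracting
    vertices, so whatever root c reaches is itself attracting. *)
Lemma rootedE f S c : c \in attractor f ->
  rooted f S = (S :&: attractor f != finset.set0).
Proof.
move=> /attractorP cC; apply/forallP/set0Pn => [/(_ c) /exists_inP[w wS cw]|].
  exists w; rewrite inE wS; apply/attractorP => v.
  exact: connect_trans (cC v) cw.
by case=> w /setIP[wS /attractorP wC] v; apply/exists_inP; exists w.
Qed.

(** Doubling avoids the division by 2 of the binomial coefficients. *)
Lemma card_pairs_meeting S :
  (#|[set A : {set V} | (#|A| == 2) && (A :&: S != finset.set0)]|).*2 =
    (#|S| * (#|V|.*2 - #|S|.+1))%N.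
Proof.
set M := [set A | _].
have disj : M = [set A : {set V} | #|A| == 2]
                  :\: [set A : {set V} | A \subset ~: S & #|A| == 2].
  apply/setP => A; rewrite !inE -finset.disjoints_subset -setI_eq0.
  by case: (#|A| == 2); rewrite ?andbF //= !andbT.
have sub : [set A : {set V} | A \subset ~: S & #|A| == 2]
             \subset [set A : {set V} | #|A| == 2].
  by apply/fintype.subsetP => A; rewrite !inE => /andP[].
rewrite disj cardsD (finset.setIidPr sub) cards_draws card_draws !bin2.
have := cardsC S; move: #|S| #|~: S| #|V| => s t m <-.
have odd_half a : (a * a.-1)./2.*2 = (a * a.-1)%N.
  by apply: (@even_halfK (a * a.-1)); case: a => //= a; rewrite oddM /= andNb.
by rewrite doubleB !odd_half; case: s => [|s]; case: t => [|t] /=; nia.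
Qed.

Lemma rooted_count2 f : attractor f != finset.set0 ->
  (rooted_count 2 f).*2 = (#|attractor f| * (#|V|.*2 - #|attractor f|.+1))%N.
Proof.
case/set0Pn=> c cC; rewrite -card_pairs_meeting; congr _.*2.
by apply: eq_card => A; rewrite !inE (rootedE _ cC).
Qed.

End RootedSets.

(** * The Markov chain tree theorem *)

Definition fun_weight (R : nzRingType) n (T : 'M[R]_n) (f : {ffun 'I_n -> 'I_n}) : R :=
  \prod_i T i (f i).

Definition fun_mx (R : nzRingType) n (f : {ffun 'I_n -> 'I_n}) : 'M[R]_n :=
  \matrix_(i, j) (f i == j)%:R.

Lemma det_sum_rows (R : comNzRingType) n (t : 'I_n -> 'I_n -> R)
    (X : 'I_n -> 'I_n -> 'I_n -> R) :
  \det (\matrix_(i, j) \sum_k t i k * X i k j) =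
    \sum_(f : {ffun 'I_n -> 'I_n})
      (\prod_i t i (f i)) * \det (\matrix_(i, j) X i (f i) j).
Proof.
rewrite [LHS]/determinant.
under [RHS]eq_bigr do rewrite [\det _]/determinant mulr_sumr.
rewrite [RHS]exchange_big /=; apply: eq_bigr => s _.
under eq_bigr do rewrite mxE.
rewrite bigA_distr_bigA mulr_sumr; apply: eq_bigr => f _ /=.
rewrite big_split mulrCA; congr (_ * (_ * _)).
by apply: eq_bigr => i _; rewrite mxE.
Qed.

(** If every orbit meets S, a permutation contributing to the determinant and
    moving a point i must send it to f i, then f i to f (f i), and so on, until
    it moves a point of S, which is impossible: only the identity contributes.
    Otherwise the indicator of the set of vertices whose orbit avoids S is in
    the kernel. *)
Lemma det_grounded_fun (R : fieldType) n (f : {ffun 'I_n -> 'I_n}) (S : {set 'I_n}) :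
  \det (grounded (fun_mx R f) S) = (rooted f S)%:R.
Proof.
have [rS|/forallPn[u]] := boolP (rooted f S).
  have f_moves i : i \notin S -> f i != i.
    move=> iS; apply: contraNneq iS => fi.
    have /exists_inP[w wS iw] := forallP rS i.
    have /eqP <- : w == i; last by [].
    by apply: (@fconnect_stable _ f (pred1 i) i) iw => //= v /eqP ->; apply/eqP.
  rewrite /determinant (bigD1 1%g) //= [X in _ + X]big1 ?addr0 => [|s s1].
    rewrite odd_perm1 expr0 mul1r big1 // => i _.
    rewrite !mxE perm1 eqxx; case: ifPn => // iS.
    by rewrite (negbTE (f_moves i iS)) subr0.
  apply/eqP; rewrite mulf_eq0 signr_eq0 /=; apply: contraNT s1 => nz.
  have nzi i : grounded (fun_mx R f) S i (s i) != 0.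
    by apply: contraNneq nz => z; rewrite (bigD1 i) //= z mul0r.
  have sE i : s i != i -> i \notin S /\ s i = f i.
    move=> si; have := nzi i; rewrite !mxE [i == _]eq_sym (negbTE si).
    case: (i \in S); first by rewrite eqxx.
    by rewrite sub0r oppr_eq0 [f i == _]eq_sym; case: (s i =P f i) => // _ /eqP.
  apply/eqP/permP => i; rewrite perm1; apply/eqP/negPn/negP => si.
  have /exists_inP[w wS iw] := forallP rS i.
  have : s w != w.
    apply: (@fconnect_stable _ f (fun v => s v != v) i) iw => // v sv.
    have [_ <-] := sE v sv; by rewrite (inj_eq perm_inj).
  by case/sE => /negP[].
rewrite negb_exists_in => /forall_inP uS.
(* U is the set of vertices whose orbit avoids S. *)
pose U := [set v | [forall w in S, ~~ fconnect f v w]].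
have UP v : reflect (forall w, w \in S -> ~~ fconnect f v w) (v \in U).
  by rewrite inE; apply: forall_inP.
pose x : 'cV[R]_n := \col_i (i \in U)%:R.
have Nx : grounded (fun_mx R f) S *m x = 0.
  apply/matrixP => i j; rewrite !mxE.
  have [iS|iS] := boolP (i \in S).
    rewrite (bigD1 i) //= big1 => [|k ki].
      rewrite !mxE iS eqxx addr0 mul1r; case: (UP i) => // /(_ i iS).
      by rewrite connect0.
    by rewrite !mxE iS eq_sym (negbTE ki) mul0r.
  under eq_bigr do rewrite !mxE (negbTE iS) mulrBl.
  rewrite sumrB (bigD1 i) //= big1 => [|k ki]; last first.
    by rewrite eq_sym (negbTE ki) mul0r.
  rewrite eqxx mul1r addr0 (bigD1 (f i)) //= big1 => [|k ki]; last first.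
    by rewrite eq_sym (negbTE ki) mul0r.
  rewrite eqxx mul1r addr0; apply/eqP; rewrite subr_eq0; apply/eqP.
  congr (_%:R); congr nat_of_bool; apply/UP/UP => iU w wS.
    by have := iU w wS; rewrite fconnect_eqVf negb_or => /andP[].
  rewrite fconnect_eqVf negb_or iU // andbT.
  by apply: contraNneq iS => ->.
apply/eqP/contraT => d0; have := congr1 (mulmx (\adj (grounded (fun_mx R f) S))) Nx.
rewrite mulmxA mul_adj_mx mulmx0 mul_scalar_mx => /matrixP /(_ u ord0).
rewrite !mxE; have -> : u \in U by apply/UP.
by rewrite mulr1 => /eqP; rewrite (negbTE d0).
Qed.

(** The Markov chain tree theorem: as the rows of T sum to 1, every row of
    grounded T S is the T-average of the rows of the grounded functional
    matrices, and the determinant is multilinear in the rows. *)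
Lemma forest_sumE (R : fieldType) n (T : 'M[R]_n) k :
  (forall i, \sum_j T i j = 1) ->
  forest_sum k T = \sum_f fun_weight T f * (rooted_count k f)%:R.
Proof.
move=> T1.
transitivity (\sum_(S : {set 'I_n} | #|S| == k) \sum_f fun_weight T f * (rooted f S)%:R).
  apply: eq_bigr => S _.
  have -> : grounded T S = \matrix_(i, j) \sum_l T i l *
      (if i \in S then (i == j)%:R else (i == j)%:R - (l == j)%:R).
    apply/matrixP => i j; rewrite !mxE; case: (i \in S).
      by rewrite -mulr_suml T1 mul1r.
    under eq_bigr do rewrite mulrBr.
    rewrite sumrB -mulr_suml T1 mul1r; congr (_ - _).
    rewrite (bigD1 j) //= big1 ?eqxx ?mulr1 ?addr0 // => l lj.
    by rewrite (negbTE lj) mulr0.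
  rewrite (@det_sum_rows _ _ T (fun i l j => if i \in S then
     (i == j)%:R else (i == j)%:R - (l == j)%:R)).
  apply: eq_bigr => f _; rewrite -det_grounded_fun; congr (_ * \det _).
  by apply/matrixP => i j; rewrite !mxE.
rewrite exchange_big; apply: eq_bigr => f _; rewrite -mulr_sumr; congr (_ * _).
rewrite -natr_sum; congr (_%:R); rewrite /rooted_count -sum1_card.
rewrite [LHS]big_mkcond [RHS]big_mkcond; apply: eq_bigr => S _.
by rewrite inE; case: (#|S| == k) => //=; case: (rooted f S).
Qed.

(** * Single essential class *)

Lemma forest_sum0_eq0 (R : fieldType) n (T : 'M[R]_n) :
  (0 < n)%N -> (forall i, \sum_j T i j = 1) -> forest_sum 0 T = 0.
Proof.
move=> n0 T1; rewrite forest_sumE // big1 // => f _.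
by rewrite rooted_count0 ?mulr0 // card_ord.
Qed.

Lemma fun_weight_ge0 (R : realType) n (T : 'M[R]_n) f :
  stochastic T -> 0 <= fun_weight T f.
Proof. by case=> T0 _; apply: prodr_ge0 => i _. Qed.

Lemma forest_sum1_gt0 (R : realType) n (T : 'M[R]_n) : stochastic T ->
  reflect (exists f, 0 < fun_weight T f /\ attractor f != finset.set0)
          (0 < forest_sum 1 T).
Proof.
move=> sT; have T1 := proj2 sT; rewrite forest_sumE //.
have ge0 f : 0 <= fun_weight T f * (rooted_count 1 f)%:R.
  by rewrite mulr_ge0 ?ler0n ?fun_weight_ge0.
apply: (iffP idP) => [|[f [wf Cf]]].
  move=> F1; have [/existsP[f /andP[wf cf]]|/existsPn no] :=
    boolP [exists f, (0 < fun_weight T f) && (attractor f != finset.set0)].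
    by exists f.
  move: F1; rewrite big1 ?ltxx // => f _; have := no f.
  rewrite lt_def fun_weight_ge0 // andbT rooted_count1 negb_and !negbK.
  by case/orP => /eqP ->; rewrite ?mul0r // cards0 mulr0.
rewrite (bigD1 f) //=; apply: ltr_pwDl; last exact: sumr_ge0.
by rewrite mulr_gt0 // ltr0n rooted_count1 card_gt0.
Qed.

Lemma connect_weight (R : realType) n (T : 'M[R]_n) (f : {ffun 'I_n -> 'I_n}) :
  0 < fun_weight T f -> stochastic T -> 
  forall u v, fconnect f u v -> connect (arc T) u v.
Proof.
move=> wf [T0 _]; apply: connect_sub => u _ /eqP <-; apply: connect1.
rewrite /arc lt_def T0 andbT; apply: contraTneq wf => z.
by rewrite /fun_weight (bigD1 u) //= z mul0r ltxx.
Qed.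

(** From any vertex u, a reachable v that itself reaches the fewest vertices
    is essential; so a unique essential class is reached from everywhere. *)
Lemma single_essential_classP (R : realType) n (T : 'M[R]_n) :
  single_essential_class T <-> exists c, forall u, connect (arc T) u c.
Proof.
pose reach u := [set v | connect (arc T) u v].
have reach_ess v : (forall w, connect (arc T) v w -> connect (arc T) w v) ->
    essential_class T (reach v).
  move=> ess; split.
  - by apply/set0Pn; exists v; rewrite inE.
  - move=> i; rewrite inE => vi k ik.
    exact: connect_trans (ess _ (connect_trans vi ik)) vi.
  - by move=> i j; rewrite !inE => vi vj; apply: connect_trans (ess _ vi) vj.
  - move=> i j; rewrite !inE => vi; apply: contra => ij.
    exact: connect_trans vi ij.
split=> [[C [ec uC]]|[c cP]].
  have [/set0Pn[c cC] _ _ _] := ec; exists c => u.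
  (* v is reachable from u, with the fewest vertices reachable from it *)
  case: (@arg_minnP _ u (fun v => connect (arc T) u v) (fun v => #|reach v|)) => // v uv vmin.
  have ess w : connect (arc T) v w -> connect (arc T) w v.
    move=> vw; have sub : reach w \subset reach v.
      by apply/fintype.subsetP => x; rewrite !inE; apply: connect_trans.
    have /eqP E : reach w == reach v.
      by rewrite eqEcard sub vmin // (connect_trans uv vw).
    have : v \in reach w by rewrite E inE connect0.
    by rewrite inE.
  have := uC _ (reach_ess v ess) => E.
  have : c \in reach v by rewrite -E.
  by rewrite inE; apply: connect_trans.
exists (reach c); split=> [|C [/set0Pn[i iC] _ Ccon Cclosed]].
  by apply: reach_ess => w _; apply: cP.
have cC : c \in C.
  by apply/negPn/negP => /(Cclosed _ _ iC) /negP; apply; apply: cP.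
apply/setP => j; rewrite inE; apply/idP/idP => [|/(Ccon _ _ cC) //].
by apply: contraTT => /(Cclosed _ _ cC).
Qed.

(** Let f follow a shortest path towards c, and leave c along any arc. *)
Lemma exists_tree (R : realType) n (T : 'M[R]_n) c :
  stochastic T -> (forall u, connect (arc T) u c) ->
  exists2 f, 0 < fun_weight T f & c \in attractor f.
Proof.
move=> [T0 T1] cP.
(* P u m: there is a walk of length m from u to c. *)
pose P u m := [exists p : m.-tuple 'I_n, path (arc T) u p && (last u p == c)].
have exP u : exists m, P u m.
  have /connectP[p up cE] := cP u; exists (size p).
  by apply/existsP; exists (in_tuple p); rewrite up -cE eqxx.
pose dist u := ex_minn (exP u).
have dist0 : dist c = 0%N.
  rewrite /dist; case: ex_minnP => m _ /(_ 0%N); rewrite leqn0 => H.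
  apply/eqP/H; apply/existsP; exists [tuple]; by rewrite /= eqxx.
have out u : exists v, arc T u v && ((u == c) || (dist v < dist u)%N).
  have [->|uc] /= := eqVneq u c.
    case: (pickP (arc T c)) => [v cv|no]; first by exists v; rewrite cv.
    have := T1 c; rewrite big1 => [/esym/eqP|v _]; first by rewrite oner_eq0.
    by apply/eqP; move: (no v); rewrite /arc lt_def T0 andbT; case: eqP.
  rewrite {2}/dist; case: ex_minnP => -[|m] /existsP[[p /= /eqP sp]].
    by rewrite (size0nil sp) /= (negbTE uc).
  case: p sp => //= v p [sp] /andP[/andP[uv vp] lp] _; exists v; rewrite uv.
  rewrite /dist; case: ex_minnP => k _ /(_ m) kmin; rewrite ltnS kmin //.
  by apply/existsP; exists (Tuple (introT eqP sp)); rewrite /= vp.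
pose f : {ffun 'I_n -> 'I_n} := [ffun u => xchoose (out u)].
have fP u : arc T u (f u) && ((u == c) || (dist (f u) < dist u)%N).
  by rewrite ffunE; exact: (xchooseP (out u)).
exists f; first by apply: prodr_gt0 => u _; case/andP: (fP u).
apply/attractorP => u; move: {-1}(dist u) (leqnn (dist u)) => m.
elim: m u => [|m IHm] u.
  rewrite leqn0 => /eqP d0; case/andP: (fP u); rewrite d0 ltn0 orbF => _ /eqP ->.
  exact: connect0.
move=> du; rewrite fconnect_eqVf; case/andP: (fP u) => _.
by case: eqP => //= _ /leq_trans /(_ du); rewrite ltnS => /IHm.
Qed.

Lemma single_essential_class_gt0 (R : realType) n (T : 'M[R]_n) :
  stochastic T -> (single_essential_class T <-> 0 < forest_sum 1 T).
Proof.
move=> sT; split.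
  case/single_essential_classP => c /(exists_tree sT)[f wf cf].
  by apply/(forest_sum1_gt0 sT); exists f; split=> //; apply/set0Pn; exists c.
case/(forest_sum1_gt0 sT) => f [wf /set0Pn[c /attractorP cC]].
apply/single_essential_classP; exists c => u.
exact: connect_weight wf sT _ _ (cC u).
Qed.

(** * Levels of a rooted tree *)

Section Levels.
Variables (R : realFieldType) (N : nat) (w : 'I_N -> R).
Hypothesis w_ge0 : forall i, 0 <= w i.
Implicit Types (e : 'I_N -> nat).

(** If a vertex i has depth e i + 1 in a tree, Kemeny's constant of the
    corresponding matrix is N - level_num e / (2 level_den e). *)
Definition level_num e : R := \sum_i ((e i).+1 * (e i).+2)%:R * w i.
Definition level_den e : R := 1 + \sum_i (e i).+1%:R * w i.

Lemma level_den_gt0 e : 0 < level_den e.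
Proof. by rewrite ltr_pwDl // sumr_ge0 // => i _; rewrite mulr_ge0. Qed.

Lemma level_num_le e H : (forall i, (e i < H)%N) ->
  level_num e <= H.+1%:R * level_den e.
Proof.
move=> eH; rewrite mulrDr mulr1 -[leLHS]add0r lerD ?ler0n // mulr_sumr.
apply: ler_sum => i _; rewrite mulrA -natrM ler_wpM2r // ler_nat mulnC.
by rewrite leq_mul2r ltnS eH orbT.
Qed.

Lemma level_sum_update e a H (F : nat -> R) :
  \sum_i F (if i == a then H else e i) * w i =
    \sum_i F (e i) * w i + (F H - F (e a)) * w a.
Proof.
rewrite (bigD1 a) //= [in RHS](bigD1 a) //= eqxx.
rewrite [X in _ + X](eq_bigr (fun i => F (e i) * w i)) => [|i /negbTE -> //].
by ring.
Qed.

(** Suppose that e takes exactly the values 0, ..., H - 1.  The ratio is then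
    at most H + 1 (level_num_le).  If two indices share a level l, raising one
    of them, of weight x, to the new level H adds (H - l) x to the denominator
    and (H - l)(H + l + 3) x to the numerator: the ratio of the increments is at
    least H + 1, so the ratio cannot decrease.  Iterating makes e a bijection. *)
Lemma level_path e H :
  (forall i, (e i < H)%N) -> (forall l, (l < H)%N -> exists i, e i = l) ->
  exists s : 'S_N, level_num e / level_den e <=
    level_num (fun i => s i) / level_den (fun i => s i).
Proof.
have [m] := ubnP (N - H); elim: m => // m IHm in e H *.
rewrite ltnS => NH eH surj.
have HN : (H <= N)%N.
  rewrite -(size_iota 0 H) -[leqRHS]card_ord -(size_codom e).
  apply: uniq_leq_size (iota_uniq _ _) _ => l; rewrite mem_iota add0n => /surj[i <-].
  exact: codom_f.
have [/injectiveP inj_e|/injectivePn[a [b ab eab]]] := boolP (injectiveb e).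
  have eN i : (e i < N)%N by apply: leq_trans HN.
  have inj : injective (fun i => Ordinal (eN i)) by move=> i j [] /inj_e.
  exists (perm inj); rewrite le_eqVlt; apply/orP; left; apply/eqP.
  congr ((_ / (1 + _))); apply: eq_bigr => i _; by rewrite permE.
pose e' i := if i == a then H else e i.
have e'H i : (e' i < H.+1)%N.
  by rewrite /e'; case: eqP => // _; rewrite ltnS ltnW.
have surj' l : (l < H.+1)%N -> exists i, e' i = l.
  rewrite ltnS leq_eqVlt => /orP[/eqP ->|/surj[i <-]].
    by exists a; rewrite /e' eqxx.
  have [->|ia] := eqVneq i a; last by exists i; rewrite /e' (negbTE ia).
  by exists b; rewrite /e' eq_sym (negbTE ab).
have HltN : (H < N)%N.
  rewrite -(size_iota 0 H.+1) -[leqRHS]card_ord -(size_codom e').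
  apply: uniq_leq_size (iota_uniq _ _) _ => l; rewrite mem_iota add0n => /surj'[i <-].
  exact: codom_f.
have [|s les] := IHm e' H.+1 _ e'H surj'; first by lia.
exists s; apply: le_trans les.
rewrite ler_pdivrMr ?level_den_gt0 // mulrAC ler_pdivlMr ?level_den_gt0 //.
have -> : level_num e' =
    level_num e + ((H.+1 * H.+2)%:R - ((e a).+1 * (e a).+2)%:R) * w a.
  exact: (level_sum_update e a H (fun k => (k.+1 * k.+2)%:R)).
have -> : level_den e' = level_den e + (H.+1%:R - (e a).+1%:R) * w a.
  by rewrite /level_den (level_sum_update e a H (fun k => k.+1%:R)) addrA.
have := level_num_le eH; have := level_den_gt0 e; have := w_ge0 a; have := eH a.
move: (level_num e) (level_den e) (e a) (w a) => A B l x lH x0 B0 AB.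
have -> : H.+1%:R - l.+1%:R = (H - l)%:R :> R by rewrite -natrB // ltnW.
have -> : (H.+1 * H.+2)%:R - (l.+1 * l.+2)%:R = ((H - l) * (H + l + 3))%:R :> R.
  by rewrite -natrB; [congr _%:R; nia | nia].
rewrite -subr_ge0 natrM.
(* d and d * D are the coefficients of x in the two increments. *)
set d : R := (H - l)%:R; set D : R := (H + l + 3)%:R.
have -> : (A + d * D * x) * B - A * (B + d * x) = x * d * (D * B - A) by ring.
rewrite !mulr_ge0 ?ler0n // subr_ge0 (le_trans AB) // ler_wpM2r ?(ltW B0) //.
by rewrite /D ler_nat; lia.
Qed.

End Levels.

(** * Redirecting the arc that leaves one vertex *)

Section Redirect.
Variable V : finType.
Implicit Types (f : {ffun V -> V}) (z j : V).

Definition redirect f z j : {ffun V -> V} := [ffun v => if v == z then j else f v].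

Lemma redirect_self f z j : redirect f z j z = j.
Proof. by rewrite ffunE eqxx. Qed.

Lemma redirect_neq f z i j v : v != z -> redirect f z j v = redirect f z i v.
Proof. by move=> vz; rewrite !ffunE (negbTE vz). Qed.

Lemma fconnect_sink f z v : fconnect (redirect f z z) z v -> v = z.
Proof.
move=> zv; apply/eqP; apply: (fconnect_stable (Q := pred1 z)) zv => //= u /eqP ->.
by rewrite redirect_self.
Qed.

(** An orbit that never visits z is the same wherever z is sent. *)
Lemma fconnect_avoid f z j v x :
  ~~ fconnect (redirect f z z) v z ->
  fconnect (redirect f z j) v x = fconnect (redirect f z z) v x.
Proof.
set h := redirect f z z => vz.
pose Q := [pred y | ~~ fconnect h y z].
have Qh y : Q y -> Q (h y).
  by rewrite /= [fconnect h y z]fconnect_eqVf negb_or => /andP[].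
have Qz y : Q y -> y != z by apply: contraNneq => ->; apply: connect0.
apply/idP/idP.
  move=> vx; suff /andP[] : fconnect h v x && Q x by [].
  apply: (fconnect_stable (Q := [pred y | fconnect h v y && Q y])) vx.
    by rewrite /= connect0.
  move=> y /andP[vy Qy]; rewrite (redirect_neq _ z) ?Qz // -/h.
  by apply/andP; split; [apply: connect_trans vy (fconnect1 _ _) | apply: Qh].
move=> vx; suff /andP[] : fconnect (redirect f z j) v x && Q x by [].
apply: (fconnect_stable (Q := [pred y | fconnect (redirect f z j) v y && Q y])) vx.
  by rewrite /= connect0.
move=> y /andP[vy Qy]; apply/andP; split; last exact: Qh.
by rewrite /h (redirect_neq _ j) ?Qz //; apply: connect_trans vy (fconnect1 _ _).
Qed.

Section AllReach.
Variables (f : {ffun V -> V}) (z : V).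
Let h := redirect f z z.
Hypothesis hz : forall v, fconnect h v z.

Lemma fconnect_redirect_root j v : fconnect (redirect f z j) v z.
Proof.
apply/negPn/negP => nvz; have [_|] := boolP (fconnect h v z); last by rewrite hz.
pose Q := [pred y | ~~ fconnect (redirect f z j) y z].
suff : Q z by rewrite /= connect0.
apply: (fconnect_stable (Q := Q)) (hz v) => // y /= nyz.
have yz : y != z by apply: contraNneq nyz => ->; apply: connect0.
rewrite /h (redirect_neq _ j) //; apply: contra nyz => yz'.
exact: connect_trans (fconnect1 _ _) yz'.
Qed.

(** Sending the root z of a tree to j closes the path from j up to z into the
    unique cycle. *)
Lemma attractor_redirect j : attractor (redirect f z j) = [set v | fconnect h j v].
Proof.
apply/setP => v; rewrite [RHS]inE; apply/attractorP/idP => [/(_ z) zv|jv u].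
  apply: (fconnect_stable (Q := fconnect h j)) zv => // y jy.
  have [->|yz] := eqVneq y z; first by rewrite redirect_self connect0.
  by rewrite (redirect_neq _ z) //; apply: connect_trans jy (fconnect1 _ _).
apply: connect_trans (fconnect_redirect_root j u) _.
apply: (fconnect_stable (Q := fconnect (redirect f z j) z)) jv.
  by rewrite -{2}(redirect_self f z j) fconnect1.
move=> y zy; have [->|yz] := eqVneq y z; first by rewrite redirect_self.
by rewrite /h (redirect_neq _ j) //; apply: connect_trans zy (fconnect1 _ _).
Qed.

Lemma card_attractor_redirect j :
  #|attractor (redirect f z j)| = fingraph.order h j.
Proof. by rewrite attractor_redirect; apply: eq_card => v; rewrite inE. Qed.

Lemma order_root : fingraph.order h z = 1%N.
Proof.
rewrite /fingraph.order -(card1 z); apply: eq_card => v.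
apply/idP/eqP => [/fconnect_sink //|->]; exact: connect0.
Qed.

Lemma order_step v : v != z -> fingraph.order h v = (fingraph.order h (h v)).+1.
Proof.
move=> vz; rewrite /fingraph.order.
have nv : v \notin fconnect h (h v).
  apply/negP => hvv; case/eqP: vz; apply: (@fconnect_sink f z).
  apply: (fconnect_stable (Q := fun x => fconnect h x v)) (hz v) => // x.
  by rewrite fconnect_eqVf => /orP[/eqP ->|].
rewrite -add1n -[1%N]/(nat_of_bool true) -nv -cardU1.
by apply: eq_card => x; rewrite !inE [LHS]fconnect_eqVf eq_sym.
Qed.

Lemma order_gt1 v : v != z -> (1 < fingraph.order h v)%N.
Proof. by move=> /order_step ->; rewrite ltnS fingraph.order_gt0. Qed.

End AllReach.
End Redirect.

(** * Root counts averaged over one vertex *)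

Lemma rooted_count2_natr (R : realFieldType) (V : finType) (f : {ffun V -> V}) :
  attractor f != finset.set0 ->
  (rooted_count 2 f)%:R =
    #|attractor f|%:R * (#|V|%:R *+ 2 - 1 - #|attractor f|%:R) / 2 :> R.
Proof.
move=> Cf; have := congr1 (fun m => m%:R : R) (rooted_count2 Cf).
have cV : (#|attractor f| <= #|V|)%N by apply: max_card.
rewrite /= natrM natrB; last first.
  by move: Cf cV; rewrite -card_gt0; move: #|attractor f| #|V|; lia.
rewrite -!muln2 !natrM -natr1 => E; apply: (mulIf (x := 2)) => //.
by rewrite E mulfVK //; ring.
Qed.

(** A ratio of weighted sums lies above one of the ratios of the terms. *)
Lemma le_mediant (R : realFieldType) (I : finType) (a x y : I -> R) :
  (forall i, 0 <= a i) -> (forall i, 0 <= x i) -> (forall i, 0 <= y i) ->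
  0 < \sum_i a i * x i ->
  exists2 i, 0 < x i & y i / x i <= (\sum_i a i * y i) / (\sum_i a i * x i).
Proof.
move=> a0 x0 y0 X0.
have [/existsP[i /andP[xi yi]]|/existsPn no] :=
  boolP [exists i, (0 < x i) && (y i / x i <= (\sum_i a i * y i) / (\sum_i a i * x i))].
  by exists i.
set Q := _ / _ in no.
have lt_yi i : 0 < x i -> Q * x i < y i.
  by move=> xi; have := no i; rewrite xi /= -ltNge ltr_pdivlMr.
have term_ge0 i : true -> 0 <= a i * (y i - Q * x i).
  move=> _; rewrite mulr_ge0 // subr_ge0.
  have := x0 i; rewrite le_eqVlt => /orP[/eqP <-|/lt_yi/ltW //].
  by rewrite mulr0.
have sum0 : \sum_i a i * (y i - Q * x i) = 0.
  under eq_bigr do rewrite mulrBr mulrCA.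
  by rewrite sumrB -mulr_sumr /Q divfK ?subrr // gt_eqF.
exfalso; move: X0; rewrite big1 ?ltxx // => i _.
have := psumr_eq0P (P := xpredT) (fun i => @term_ge0 i) sum0 (i := i) isT.
move/eqP; rewrite mulf_eq0.
case/orP => /eqP E; first by rewrite E mul0r.
have := x0 i; rewrite le_eqVlt => /orP[/eqP <-|/lt_yi]; first by rewrite mulr0.
by rewrite -subr_gt0 E ltxx.
Qed.

Section RootSums.
Variables (R : realFieldType) (N : nat) (rho : 'I_N.+1 -> R).
Hypothesis rho_ge0 : forall j, 0 <= rho j.
Hypothesis rho_sum1 : \sum_j rho j = 1.
Implicit Type f : {ffun 'I_N.+1 -> 'I_N.+1}.
Local Notation z := (@ord_max N).

(** The vertices other than z, read backwards: if row z is
    (r_N, ..., r_1, r_0), then inner i has weight r_(i+1). *)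
Definition inner (i : 'I_N) : 'I_N.+1 := rev_ord (lift ord0 i).

(** The value of F_k for the matrix whose row z is rho and whose other rows
    are those of the functional matrix of f. *)
Definition root_sum k f : R :=
  \sum_j rho j * (rooted_count k (redirect f z j))%:R.

Lemma root_sum_ge0 k f : 0 <= root_sum k f.
Proof. by apply: sumr_ge0 => j _; rewrite mulr_ge0. Qed.

Lemma big_inner (G : 'I_N.+1 -> R) : \sum_j G j = G z + \sum_i G (inner i).
Proof.
rewrite (reindex_inj rev_ord_inj) big_ord_recl; congr (G _ + _).
by apply: val_inj; rewrite /= subn1.
Qed.

Lemma inner_neq i : inner i != z.
Proof.
by apply/eqP => /(congr1 (@rev_ord _)); rewrite rev_ordK => /(congr1 val); rewrite /= /bump; lia.
Qed.

Lemma innerP v : v != z -> exists i, v = inner i.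
Proof.
move=> vz; case: (unliftP ord0 (rev_ord v)) => [i E|E].
  by exists i; rewrite /inner -E rev_ordK.
case/eqP: vz; apply: (can_inj (@rev_ordK _)); rewrite E.
by apply: val_inj; rewrite /= subnn.
Qed.

(** Sending z to a vertex of depth d closes a cycle of length d + 1, so that
    there are d + 1 attracting vertices; the pairs that meet the cycle are
    counted by rooted_count2. *)
Lemma tree_root_sums f (e : 'I_N -> nat) :
  (forall v, fconnect (redirect f z z) v z) ->
  (forall i, fingraph.order (redirect f z z) (inner i) = (e i).+2) ->
  let w i := rho (inner i) in
  root_sum 1 f = level_den w e /\
  root_sum 2 f = N%:R * level_den w e - level_num w e / 2.
Proof.
move=> hz he w.
have S2 m : m.+2%:R = m%:R + 2 :> R by rewrite -addn2 natrD.
have S1 m : m.+1%:R = m%:R + 1 :> R by rewrite -addn1 natrD.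
have SN := S1 N.
have rz : rho z = 1 - \sum_i w i by rewrite -rho_sum1 big_inner addrK.
have c1 j : (rooted_count 1 (redirect f z j))%:R =
    (fingraph.order (redirect f z z) j)%:R :> R.
  by rewrite rooted_count1 card_attractor_redirect.
have c2 j : (rooted_count 2 (redirect f z j))%:R =
    (fingraph.order (redirect f z z) j)%:R *
    (N.+1%:R *+ 2 - 1 - (fingraph.order (redirect f z z) j)%:R) / 2 :> R.
  rewrite rooted_count2_natr ?card_attractor_redirect ?card_ord //.
  by rewrite -card_gt0 card_attractor_redirect ?fingraph.order_gt0.
set o := fun j => (fingraph.order (redirect f z z) j)%:R : R in c1 c2.
have oz : o z = 1 by rewrite /o order_root.
have oi i : o (inner i) = (e i).+2%:R by rewrite /o he.
have -> : root_sum 1 f = o z * rho z + \sum_i (e i).+2%:R * w i.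
  rewrite -(eq_bigr _ (fun i _ => congr1 ( *%R^~ (w i)) (oi i))).
  rewrite -(big_inner (fun j => o j * rho j)).
  by apply: eq_bigr => j _; rewrite c1 mulrC.
have -> : root_sum 2 f = rho z * (o z * (N.+1%:R *+ 2 - 1 - o z) / 2) +
    \sum_i w i * ((e i).+2%:R * (N.+1%:R *+ 2 - 1 - (e i).+2%:R) / 2).
  under [X in _ + X]eq_bigr do rewrite -oi.
  rewrite -(big_inner (fun j => rho j * (o j * (N.+1%:R *+ 2 - 1 - o j) / 2))).
  by apply: eq_bigr => j _; rewrite c2.
rewrite oz rz /level_den /level_num.
split.
  rewrite mul1r -addrA; congr (_ + _); rewrite addrC -sumrB.
  by apply: eq_bigr => i _; rewrite S2 S1; ring.
have -> : \sum_i w i * ((e i).+2%:R * (N.+1%:R *+ 2 - 1 - (e i).+2%:R) / 2) =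
    N%:R * (\sum_i w i) + N%:R * (\sum_i (e i).+1%:R * w i)
      - (\sum_i ((e i).+1 * (e i).+2)%:R * w i) / 2.
  rewrite !mulr_sumr mulr_suml -big_split -sumrB; apply: eq_bigr => i _ /=.
  by rewrite natrM SN S2 S1; field.
by rewrite SN; field.
Qed.

(** In a tree the levels form an initial segment, since the image of a vertex
    lies one level closer to the root. *)
Lemma levels_inhabited f : let h := redirect f z z in
  (forall v, fconnect h v z) ->
  exists (e : 'I_N -> nat) (H : nat),
    [/\ forall i, fingraph.order h (inner i) = (e i).+2,
        forall i, (e i < H)%N & forall l, (l < H)%N -> exists i, e i = l].
Proof.
move=> h hz; pose e i := (fingraph.order h (inner i)).-2.
have eE i : fingraph.order h (inner i) = (e i).+2.
  by rewrite /e; have := order_gt1 hz (inner_neq i); rewrite -/h; lia.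
exists e, (\max_i (e i).+1); split=> // [i|l].
  exact: (leq_bigmax_cond (F := fun i => (e i).+1)).
move=> lH; have [i li] : exists i, (l <= e i)%N.
  apply/existsP/contraT => /existsPn no; move: lH; rewrite ltnNge => /negP[].
  by apply/bigmax_leqP => i _; have := no i; rewrite -ltnNge.
elim: (e i - l)%N {-2}i (erefl (e i - l)%N) li => [|m IHm] j.
  by move=> El lj; exists j; lia.
move=> El lj; have := order_step hz (inner_neq j); rewrite -/h eE => -[E].
have [k Ek] : exists k, h (inner j) = inner k.
  apply: innerP; apply/eqP => hjz; move: E.
  by rewrite hjz [fingraph.order h z]order_root; lia.
by move: E; rewrite Ek eE => -[E]; apply: (IHm k); lia.
Qed.

Lemma tree_bound f : (forall v, fconnect (redirect f z z) v z) ->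
  exists s : 'S_N,
    N%:R - level_num (fun i => rho (inner i)) (fun i => s i) /
           level_den (fun i => rho (inner i)) (fun i => s i) / 2
      <= root_sum 2 f / root_sum 1 f.
Proof.
move=> hz; have [e [H [eE eH surj]]] := levels_inhabited hz.
have w0 i : 0 <= rho (inner i) by [].
have [s les] := level_path w0 eH surj; exists s.
have [-> ->] := tree_root_sums hz eE.
have d0 := level_den_gt0 w0 e.
rewrite mulrBl mulfK ?gt_eqF // lerD2l lerN2 mulrAC.
by rewrite ler_pM2r // invr_gt0.
Qed.

(** An orbit that avoids z ends in a cycle K which persists wherever z is
    sent.  For the targets j in a set J of total weight sigma, K attracts
    everything, which gives F_1 = sigma k with k = #|K|; the other targets leave
    a second cycle and contribute nothing to F_1.  But if z is sent to itself,
    z and any point of K form a rooted pair, which adds at least rho z * k to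
    F_2.  As sigma <= 1 - rho z and k <= N, the bound follows. *)
Lemma cycle_bound f u : ~~ fconnect (redirect f z z) u z -> 0 < root_sum 1 f ->
  rho z < 1 /\
  (N.+1%:R - 2) / 2 + 1 / (1 - rho z) <= root_sum 2 f / root_sum 1 f.
Proof.
set h := redirect f z z => uz X0.
have attr_h : attractor h = finset.set0.
  apply/finset.setP => c; rewrite finset.in_set0; apply/attractorP => cC.
  by move: (cC u); rewrite (fconnect_sink (cC z)) (negbTE uz).
(* J is the set of targets of z for which a single cycle is left. *)
pose J := [pred j | attractor (redirect f z j) != finset.set0].
have zJ j : J j -> j != z by apply: contraTneq => ->; rewrite /= -/h attr_h eqxx.
have u_reach j c : c \in attractor (redirect f z j) -> fconnect h u c.
  by move=> /attractorP /(_ u); rewrite fconnect_avoid.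
have c_avoid c : fconnect h u c -> ~~ fconnect h c z.
  by move=> uc; apply: contra uz; apply: connect_trans.
have attr_sub i j : J j -> attractor (redirect f z i) \subset attractor (redirect f z j).
  case/set0Pn => d dC; apply/fintype.subsetP => c cC; apply/attractorP => v.
  apply: connect_trans (attractorP _ _ dC v) _.
  have dz := c_avoid _ (u_reach _ _ dC).
  by rewrite fconnect_avoid // -(fconnect_avoid i) //; apply: (attractorP _ _ cC).
have [j0 J0] : exists j, J j.
  apply/existsP/contraT => /existsPn no; move: X0; rewrite /root_sum big1 ?ltxx // => j _.
  by have := no j; rewrite negbK rooted_count1 => /eqP ->; rewrite cards0 mulr0.
set K := attractor (redirect f z j0) in J0.
have attrE j : attractor (redirect f z j) = if J j then K else finset.set0.
  case: ifPn => [Jj|]; last by rewrite negbK => /eqP.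
  by apply/eqP; rewrite finset.eqEsubset; apply/andP; split; apply: attr_sub.
set k := #|K|.
have k0 : (0 < k)%N by rewrite card_gt0.
have kN : (k <= N)%N.
  have zK : z \notin K.
    apply/negP => /u_reach; apply/negP; exact: uz.
  rewrite -ltnS -[leqRHS]card_ord -(cardsT 'I_N.+1); apply: proper_card.
  rewrite properE finset.subsetT /=; apply/negP => /fintype.subsetP /(_ z).
  by rewrite (negbTE zK) inE => /(_ isT).
have count_h : (k <= rooted_count 2 h)%N.
  rewrite /k -(@card_in_imset _ _ (fun c => [set z; c])); last first.
    move=> c d cK dK /setP /(_ c); rewrite !inE eqxx orbT.
    have cz : c != z by apply: contraNneq (c_avoid _ (u_reach _ _ cK)) => ->; apply: connect0.
    by rewrite (negbTE cz) => /esym/eqP.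
  apply/subset_leq_card/fintype.subsetP => S /imsetP[c cK ->]; rewrite inE.
  have cz : c != z by apply: contraNneq (c_avoid _ (u_reach _ _ cK)) => ->; apply: connect0.
  rewrite cards2 [z == c]eq_sym cz /=; apply/forallP => v; apply/exists_inP.
  have [vz|vz] := boolP (fconnect h v z); first by exists z; rewrite // !inE eqxx.
  exists c; first by rewrite !inE eqxx orbT.
  by rewrite -(fconnect_avoid j0) //; apply: (attractorP _ _ cK).
pose sigma := \sum_(j | J j) rho j.
have F1 : root_sum 1 f = sigma * k%:R.
  rewrite /root_sum /sigma mulr_suml [RHS]big_mkcond; apply: eq_bigr => j _.
  by rewrite rooted_count1 attrE; case: (J j); rewrite ?cards0 ?mulr0.
have F2 : rho z * k%:R + sigma * (k%:R * (N.+1%:R *+ 2 - 1 - k%:R) / 2) <= root_sum 2 f.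
  rewrite /root_sum (bigD1 z) //= lerD //; first by rewrite ler_wpM2l // ler_nat.
  rewrite /sigma mulr_suml big_mkcond [leRHS]big_mkcond; apply: ler_sum => j _.
  case: ifPn => [Jj|_]; last by case: ifP => // _; rewrite mulr_ge0.
  by rewrite (zJ _ Jj) (rooted_count2_natr _ Jj) attrE Jj card_ord lexx.
have kR0 : 0 < k%:R :> R by rewrite ltr0n.
have s0 : 0 < sigma by move: X0; rewrite F1 pmulr_lgt0.
have sz : sigma <= 1 - rho z.
  rewrite -rho_sum1 (bigD1 z) //= addrAC subrr add0r /sigma.
  rewrite big_mkcond [leRHS]big_mkcond; apply: ler_sum => j _.
  by case: ifPn => [/zJ ->|_] //; case: ifP.
have z1 : 0 < 1 - rho z by apply: lt_le_trans sz.
split; first by rewrite -subr_gt0.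
rewrite ler_pdivlMr // F1 (le_trans _ F2) //.
have kNR : k%:R <= N%:R :> R by rewrite ler_nat.
have -> : N.+1%:R = N%:R + 1 :> R by rewrite -addn1 natrD.
rewrite -subr_ge0.
have -> : rho z * k%:R + sigma * (k%:R * ((N%:R + 1) *+ 2 - 1 - k%:R) / 2) -
    ((N%:R + 1 - 2) / 2 + 1 / (1 - rho z)) * (sigma * k%:R) =
  k%:R * (sigma * (N%:R - k%:R) / 2 + rho z / (1 - rho z) * (1 - rho z - sigma)).
  by field; rewrite gt_eqF.
rewrite mulr_ge0 ?ler0n // addr_ge0 ?mulr_ge0 ?invr_ge0 ?subr_ge0 // ltW //.
by rewrite -subr_gt0.
Qed.

Lemma eq_root_sum k f (g : {ffun _ -> _}) : (forall v, v != z -> f v = g v) ->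
  root_sum k f = root_sum k g.
Proof.
move=> fg; apply: eq_bigr => j _.
have E : redirect f z j = redirect g z j.
  by apply/ffunP => v; rewrite !ffunE; case: eqP => // /eqP /fg.
exact: (congr1 (fun h => rho j * (rooted_count k h)%:R) E).
Qed.

End RootSums.

(** * Kemeny's constant as a mediant over functional digraphs *)

(** Exchanging j with f z is an involution on the pairs (f, j) which swaps the
    weights of the two choices for the image of z. *)
Lemma fun_weight_redirect (R : fieldType) n (T : 'M[R]_n) z (F : {ffun 'I_n -> 'I_n} -> R) :
  \sum_j T z j = 1 ->
  \sum_f fun_weight T f * F f =
    \sum_f fun_weight T f * \sum_j T z j * F (redirect f z j).
Proof.
move=> Tz.
transitivity (\sum_f \sum_j fun_weight T f * (T z j * F f)).
  by apply: eq_bigr => f _; rewrite -mulr_sumr -mulr_suml Tz mul1r.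
transitivity (\sum_f \sum_j fun_weight T f * (T z j * F (redirect f z j))); last first.
  by apply: eq_bigr => f _; rewrite mulr_sumr.
rewrite !pair_bigA /=.
pose swap (p : {ffun 'I_n -> 'I_n} * 'I_n) := (redirect p.1 z p.2, p.1 z).
have swapK : involutive swap.
  case=> f j; rewrite /swap /= redirect_self; congr pair.
  by apply/ffunP => v; rewrite !ffunE; case: eqP => [->|].
rewrite (reindex_inj (inv_inj swapK)) /=; apply: eq_bigr => -[f j] _ /=.
rewrite /fun_weight (bigD1 z) //= [in RHS](bigD1 z) //= redirect_self.
rewrite (eq_bigr (fun i => T i (f i))) => [|i /negbTE iz]; last by rewrite ffunE iz.
by ring.
Qed.

Section Chain.
Variables (R : realType) (N : nat) (rho : 'I_N.+1 -> R).
Local Notation z := (@ord_max N).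

Lemma forest_sum_root_sum (T : 'M[R]_N.+1) k :
  stochastic T -> (forall j, T z j = rho j) ->
  forest_sum k T = \sum_f fun_weight T f * root_sum rho k f.
Proof.
move=> [_ T1] Tz; rewrite forest_sumE // (@fun_weight_redirect _ _ _ z) //.
apply: eq_bigr => f _; congr (_ * _).
by apply: eq_bigr => j _; rewrite Tz.
Qed.

Lemma kemeny_single (T : 'M[R]_N.+1) : stochastic T -> 0 < forest_sum 1 T ->
  kemeny T = forest_sum 2 T / forest_sum 1 T.
Proof.
by move=> [_ T1] F1; rewrite kemeny_forest ?gt_eqF // forest_sum0_eq0.
Qed.

Lemma kemeny_ge (T : 'M[R]_N.+1) :
  stochastic T -> single_essential_class T -> (forall j, T z j = rho j) ->
  exists2 f, 0 < root_sum rho 1 f & root_sum rho 2 f / root_sum rho 1 f <= kemeny T.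
Proof.
move=> sT /(single_essential_class_gt0 sT) F1 Tz.
have rho0 j : 0 <= rho j by rewrite -Tz; case: sT.
rewrite kemeny_single //; move: F1; rewrite !forest_sum_root_sum // => F1.
apply: le_mediant F1; [|exact: root_sum_ge0..].
by move=> f; apply: fun_weight_ge0.
Qed.

Definition redirect_mx (g : {ffun 'I_N.+1 -> 'I_N.+1}) : 'M[R]_N.+1 :=
  \matrix_(i, j) if i == z then rho j else (g i == j)%:R.

(** Every f of nonzero weight agrees with g away from z, so the average over
    f is constant. *)
Lemma kemeny_redirect_mx g : (forall j, 0 <= rho j) -> \sum_j rho j = 1 ->
  0 < root_sum rho 1 g ->
  [/\ stochastic (redirect_mx g), single_essential_class (redirect_mx g)
    & kemeny (redirect_mx g) = root_sum rho 2 g / root_sum rho 1 g].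
Proof.
move=> rho0 rho1 X0.
have sT : stochastic (redirect_mx g).
  split=> [i j|i]; first by rewrite mxE; case: eqP => // _; rewrite ler0n.
  under eq_bigr do rewrite mxE.
  case: eqP => // _; rewrite (bigD1 (g i)) //= eqxx big1 ?addr0 // => j.
  by rewrite eq_sym => /negbTE ->.
have FE k : forest_sum k (redirect_mx g) = root_sum rho k g.
  rewrite forest_sum_root_sum // => [|j]; last by rewrite mxE eqxx.
  transitivity (\sum_f fun_weight (redirect_mx g) f * root_sum rho k g).
    apply: eq_bigr => f _.
    have [w0|wf] := eqVneq (fun_weight (redirect_mx g) f) 0.
      by rewrite w0 [LHS]mul0r [RHS]mul0r.
    apply: (congr1 (GRing.mul _)); apply: eq_root_sum => v vz.
    apply/eqP; apply: contraNT wf => fg.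
    by rewrite /fun_weight (bigD1 v) //= mxE (negbTE vz) [g v == _]eq_sym (negbTE fg) mul0r.
  rewrite -mulr_suml /fun_weight -bigA_distr_bigA big1 ?mul1r //.
  by case: sT.
have F1 : 0 < forest_sum 1 (redirect_mx g) by rewrite FE.
split=> //; first exact/(single_essential_class_gt0 sT).
by rewrite kemeny_single // !FE.
Qed.

End Chain.

(** * The two extremal digraphs *)

(** A height function decreasing by one along f is the distance to z. *)
Lemma depth_order (V : finType) (f : {ffun V -> V}) (z : V) (depth : V -> nat) :
  (forall v, v != z -> depth v = (depth (f v)).+1) -> depth z = 0%N ->
  let h := redirect f z z in
  (forall v, fconnect h v z) /\ (forall v, fingraph.order h v = (depth v).+1).
Proof.
move=> df dz h.
have hz v : fconnect h v z.
  move: {-1}(depth v) (leqnn (depth v)) => m; elim: m v => [|m IHm] v.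
    by have [->|/df ->] := eqVneq v z; rewrite ?connect0.
  have [->|vz] := eqVneq v z; first by rewrite connect0.
  rewrite (df _ vz) ltnS => /IHm; apply: connect_trans.
  by have := fconnect1 h v; rewrite {2}/h ffunE (negbTE vz).
split=> // v; have [m] := ubnP (depth v); elim: m v => // m IHm v.
have [->|vz] := eqVneq v z; first by move=> _; rewrite dz order_root.
rewrite (df _ vz) ltnS => /IHm E; rewrite (order_step hz) // -/h -E.
by rewrite {2}/h ffunE (negbTE vz).
Qed.

Definition path_depth N (t : 'S_N) (v : 'I_N.+1) : 'I_N.+1 :=
  lift_perm ord0 ord0 t (rev_ord v).

(** Each vertex is sent to the one whose depth is one less; truncation of the
    predecessor leaves the root fixed. *)
Definition path_fun N (t : 'S_N) : {ffun 'I_N.+1 -> 'I_N.+1} :=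
  [ffun v => rev_ord ((lift_perm ord0 ord0 t)^-1%g (inord (path_depth t v).-1))].

Lemma path_fun_depth N (t : 'S_N) : let h := redirect (path_fun t) ord_max ord_max in
  (forall v, fconnect h v ord_max) /\
  (forall i, fingraph.order h (inner i) = (t i).+2).
Proof.
have dz : nat_of_ord (path_depth t ord_max) = 0%N.
  have -> : path_depth t ord_max = lift_perm ord0 ord0 t ord0.
    by congr (lift_perm _ _ _ _); apply: val_inj; rewrite /= subnn.
  by rewrite lift_perm_id.
have di i : nat_of_ord (path_depth t (inner i)) = (t i).+1.
  by rewrite /path_depth /inner rev_ordK lift_perm_lift.
have [||hz ho] := @depth_order _ (path_fun t) ord_max (fun v => path_depth t v).
- move=> v vz; have [i vi] := innerP vz.
  rewrite ffunE {2}/path_depth rev_ordK permKV inordK vi di //.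
  by rewrite /= ltnS ltnW.
- by [].
by split=> // i; rewrite ho di.
Qed.

(** The cycle 0 -> 1 -> ... -> N - 1 -> 0 through all vertices but N. *)
Definition cycle_fun N : {ffun 'I_N.+1 -> 'I_N.+1} :=
  [ffun v : 'I_N.+1 => if (v.+1 < N)%N then inord v.+1 else ord0].

Section Cycle.
Variables (N : nat) (N_gt0 : (0 < N)%N).
Local Notation z := (@ord_max N).
Local Notation g := (cycle_fun N).

Lemma cycle_neq (v : 'I_N.+1) : (v != z) = (v < N)%N.
Proof. by have := ltn_ord v; rewrite -val_eqE /=; lia. Qed.

Lemma cycle_fun_lt (v : 'I_N.+1) : (g v < N)%N.
Proof. by rewrite ffunE; case: ifP => // vN; rewrite inordK // ltnW. Qed.

Lemma attractor_cycle j : j != z -> attractor (redirect g z j) = [set~ z].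
Proof.
move=> jz; set f := redirect g z j.
have f_lt (v : 'I_N.+1) : (v < N)%N -> f v = g v.
  by rewrite -cycle_neq /f ffunE => /negbTE ->.
have to0 (v : 'I_N.+1) : (v < N)%N -> fconnect f v ord0.
  move: {2}(N - v)%N (erefl (N - v)%N) => m; elim: m v => [|m IHm] v E vN; first by lia.
  apply: connect_trans (fconnect1 _ _) _; rewrite f_lt // ffunE.
  case: ifP => [vN'|_]; last exact: connect0.
  by apply: IHm; rewrite inordK; lia.
have from0 m : (m < N)%N -> fconnect f ord0 (inord m).
  elim: m => [_|m IHm mN].
    by have -> : inord 0 = ord0 :> 'I_N.+1 by apply: val_inj; rewrite /= inordK.
  apply: connect_trans (IHm (ltnW mN)) _.
  have := fconnect1 f (inord m); rewrite f_lt ?inordK; try lia.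
  by rewrite ffunE inordK ?mN //; lia.
apply/setP => c; rewrite finset.in_setC1; apply/attractorP/idP => [/(_ j)|cz v].
  rewrite !cycle_neq in jz *; apply: (fconnect_stable (Q := fun v : 'I_N.+1 => (v < N)%N)) => // v vN.
  by rewrite f_lt // cycle_fun_lt.
have fv : fconnect f v ord0.
  have [vN|] := boolP (v < N)%N; first exact: to0.
  rewrite -cycle_neq negbK => /eqP ->; apply: connect_trans (fconnect1 _ _) _.
  by rewrite redirect_self to0 // -cycle_neq.
apply: connect_trans fv _; rewrite -[c]inord_val; apply: from0.
by rewrite -cycle_neq.
Qed.

Lemma cycle_count1 j : rooted_count 1 (redirect g z j) = (if j == z then 0 else N)%N.
Proof.
rewrite rooted_count1; case: eqP => [->|/eqP jz].
  apply/eqP; rewrite cards_eq0; apply/eqP/setP => c; rewrite finset.in_set0.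
  apply/attractorP => cC; have cz := fconnect_sink (cC z).
  have := cC ord0; rewrite cz => /(fconnect_stable (Q := fun v : 'I_N.+1 => (v < N)%N)).
  rewrite N_gt0 ltnn => H; suff: false by []; apply: H => // v vN.
  by move: (vN); rewrite -cycle_neq ffunE => /negbTE ->; apply: cycle_fun_lt.
by rewrite attractor_cycle // cardsC1 card_ord.
Qed.

(** When z is sent to itself, a rooted set must contain z. *)
Lemma cycle_count2_self : (rooted_count 2 (redirect g z z) <= N)%N.
Proof.
have := card_pairs_meeting [set z]; rewrite cards1 card_ord mul1n.
set M := #|_| => EM; suff : (rooted_count 2 (redirect g z z) <= M)%N by lia.
apply/subset_leq_card/fintype.subsetP => S; rewrite !inE.
case/andP => -> /forallP /(_ z) /exists_inP[w wS /fconnect_sink wz].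
by apply/set0Pn; exists z; rewrite !inE eqxx andbT -{1}wz.
Qed.

Lemma cycle_root_sums (R : realFieldType) (rho : 'I_N.+1 -> R) :
  (forall j, 0 <= rho j) -> \sum_j rho j = 1 -> rho z < 1 ->
  0 < root_sum rho 1 g /\
  root_sum rho 2 g / root_sum rho 1 g <= (N.+1%:R - 2) / 2 + 1 / (1 - rho z).
Proof.
move=> rho0 rho1 z1.
have sumD : \sum_(j | j != z) rho j = 1 - rho z.
  by rewrite -rho1 [in RHS](bigD1 z) //= addrAC subrr add0r.
have F1 : root_sum rho 1 g = (1 - rho z) * N%:R.
  rewrite /root_sum (bigD1 z) //= cycle_count1 eqxx mulr0 add0r -sumD mulr_suml.
  by apply: eq_bigr => j /negbTE jz; rewrite cycle_count1 jz.
have F2 : root_sum rho 2 g <=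
    rho z * N%:R + (1 - rho z) * (N%:R * (N.+1%:R *+ 2 - 1 - N%:R) / 2).
  rewrite /root_sum (bigD1 z) //= lerD //.
    by rewrite ler_wpM2l // ler_nat cycle_count2_self.
  rewrite -sumD mulr_suml le_eqVlt; apply/orP; left; apply/eqP.
  apply: eq_bigr => j jz.
  have cN : #|attractor (redirect g z j)| = N by rewrite attractor_cycle // cardsC1 card_ord.
  by rewrite rooted_count2_natr ?cN ?card_ord // -card_gt0 cN.
have NR : 0 < N%:R :> R by rewrite ltr0n.
have y1 : 0 < 1 - rho z by rewrite subr_gt0.
have X0 : 0 < root_sum rho 1 g by rewrite F1 mulr_gt0.
split=> //; rewrite ler_pdivrMr // (le_trans F2) // F1.
have -> : N.+1%:R = N%:R + 1 :> R by rewrite -addn1 natrD.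
rewrite le_eqVlt; apply/orP; left; apply/eqP.
by field; rewrite gt_eqF.
Qed.

End Cycle.

Lemma level_num_perm (R : realFieldType) N (w : 'I_N -> R) (s : 'S_N) :
  level_num w (fun i => (s^-1)%g i) = \sum_(j < N) (j.+1 * j.+2)%:R * w (s j).
Proof.
rewrite /level_num (reindex_inj (@perm_inj _ s)).
by apply: eq_bigr => j _; rewrite permK.
Qed.

Lemma level_den_perm (R : realFieldType) N (w : 'I_N -> R) (s : 'S_N) :
  level_den w (fun i => (s^-1)%g i) = 1 + \sum_(j < N) j.+1%:R * w (s j).
Proof.
rewrite /level_den (reindex_inj (@perm_inj _ s)); congr (_ + _).
by apply: eq_bigr => j _; rewrite permK.
Qed.

(** * Attained values and the lower bound *)

Section Attained.
Variables (R : realType) (N : nat) (rho : 'I_N.+1 -> R).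
Hypothesis rho_ge0 : forall j, 0 <= rho j.
Hypothesis rho_sum1 : \sum_j rho j = 1.
Local Notation z := (@ord_max N).

Definition path_value (s : 'S_N) : R :=
  N%:R - (\sum_(j < N) (j.+1 * j.+2)%:R * rho (inner (s j)))
           / (2 * (1 + \sum_(j < N) j.+1%:R * rho (inner (s j)))).

Lemma path_valueE s : path_value s =
  N%:R - level_num (fun i => rho (inner i)) (fun i => (s^-1)%g i)
         / level_den (fun i => rho (inner i)) (fun i => (s^-1)%g i) / 2.
Proof.
rewrite level_num_perm level_den_perm /path_value invfM; congr (_ - _).
by rewrite mulrA mulrAC.
Qed.

Lemma path_attained s : exists T : 'M[R]_N.+1,
  [/\ stochastic T, forall j, T z j = rho j, single_essential_class T
    & kemeny T = path_value s].
Proof.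
have [hz ho] := path_fun_depth (s^-1)%g.
have [E1 E2] := tree_root_sums rho_sum1 hz ho.
have d0 := level_den_gt0 (fun i => rho_ge0 (inner i)) (fun i => (s^-1)%g i).
have [|sT sgl kT] := kemeny_redirect_mx (g := path_fun (s^-1)%g) rho_ge0 rho_sum1.
  by rewrite E1.
exists (redirect_mx rho (path_fun (s^-1)%g)); split=> // [j|].
  by rewrite mxE eqxx.
rewrite kT E1 E2 path_valueE mulrBl mulfK ?gt_eqF //; congr (_ - _).
by rewrite mulrAC.
Qed.

Lemma cycle_attained : rho z < 1 -> exists T : 'M[R]_N.+1,
  [/\ stochastic T, forall j, T z j = rho j, single_essential_class T
    & kemeny T <= (N.+1%:R - 2) / 2 + 1 / (1 - rho z)].
Proof.
move=> z1; have N0 : (0 < N)%N.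
  rewrite lt0n; apply: contraTneq z1 => N0; rewrite -leNgt -rho_sum1.
  rewrite (bigD1 z) //= big1 ?addr0 // => j; rewrite -val_eqE /=.
  by have := ltn_ord j; lia.
have [X0 le] := cycle_root_sums N0 rho_ge0 rho_sum1 z1.
have [sT sgl kT] := kemeny_redirect_mx rho_ge0 rho_sum1 X0.
exists (redirect_mx rho (cycle_fun N)); split=> // [j|]; first by rewrite mxE eqxx.
by rewrite kT.
Qed.

Lemma kemeny_lower_bound (T : 'M[R]_N.+1) :
  stochastic T -> (forall j, T z j = rho j) -> single_essential_class T ->
  (exists s : 'S_N, path_value s <= kemeny T) \/
  (rho z < 1 /\ (N.+1%:R - 2) / 2 + 1 / (1 - rho z) <= kemeny T).
Proof.
move=> sT Tz sgl; have [f X0 le] := kemeny_ge sT sgl Tz.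
have [/forallP hz|/forallPn[u nuz]] :=
  boolP [forall v, fconnect (redirect f z z) v z].
  left; have [t] := tree_bound rho_ge0 rho_sum1 hz; exists (t^-1)%g.
  by rewrite path_valueE invgK; apply: le_trans le.
right; have [z1 le'] := cycle_bound rho_ge0 rho_sum1 nuz X0.
by split=> //; apply: le_trans le.
Qed.

End Attained.

Theorem theorem4p5 (R : realType) (n : nat) (r : nat -> R)
    (P : 'M[option R]_n)
    (r_ge0 : forall j, (j < n)%N -> 0 <= r j)
    (r_sum1 : \sum_(j < n) r j = 1)
    (P_psm : partial_stochastic P)
    (P_def : forall i j : 'I_n,
       P i j = if i.+1 == n then Some (r (n - j.+1)%N) else None) :
  (* the division by 1 - r 0 is that of \bar R: it gives +oo if r 0 = 1 *)
  kemeny_inf P =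
    \big[Order.min / (((n%:R - 2) / 2)%:E + 1 / (1 - r 0%N)%:E)%E]_(s : 'S_n.-1)
      (n%:R - 1 - (\sum_(j < n.-1) (j.+1 * j.+2)%:R * r (s j).+1)
                    / (2 * (1 + \sum_(j < n.-1) j.+1%:R * r (s j).+1)))%:E.
Proof.
case: n => [|N] in P r_ge0 r_sum1 P_psm P_def *.
  by move: r_sum1; rewrite big_ord0 => /esym/eqP; rewrite oner_eq0.
pose rho (j : 'I_N.+1) := r (N.+1 - j.+1)%N.
have rho_inner i : rho (inner i) = r i.+1.
  by congr r; rewrite /= /bump; have := ltn_ord i; lia.
have rho_z : rho ord_max = r 0%N by rewrite /rho subnn.
have rho_ge0 j : 0 <= rho j by apply: r_ge0; lia.
have rho_sum1 : \sum_j rho j = 1.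
  by rewrite big_inner rho_z -r_sum1 big_ord_recl; congr (_ + _); apply: eq_bigr.
have SCE T : SC P T <-> stochastic T /\ forall j, T ord_max j = rho j.
  split=> -[sT H]; split=> //; first by move=> j; apply: H; rewrite P_def eqxx.
  move=> i j x; rewrite P_def; case: eqP => // -[iN] [<-].
  by rewrite -[RHS](H j); congr (T _ _); apply: val_inj.
have fstE : rho ord_max < 1 ->
    (((N.+1%:R - 2) / 2)%:E + 1 / (1 - r 0%N)%:E)%E =
    ((N.+1%:R - 2) / 2 + 1 / (1 - rho ord_max))%:E.
  move=> z1; rewrite -rho_z inver gt_eqF ?subr_gt0 //.
rewrite /= (eq_bigr (fun s => (path_value rho s)%:E)) => [|s _]; last first.
  rewrite /path_value; congr ((_ - _ / (2 * (1 + _)))%:E).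
  - by rewrite -natr1 addrK.
  - by apply: eq_bigr => j _; rewrite rho_inner.
  - by apply: eq_bigr => j _; rewrite rho_inner.
apply/eqP; rewrite eq_le; apply/andP; split.
  apply/bigmin_geP; split=> [|s _].
  - have [z1|] := boolP (rho ord_max < 1).
      have [T [sT Tz sgl le]] := cycle_attained rho_ge0 rho_sum1 z1.
      rewrite fstE //; apply: ge_ereal_inf; exists (kemeny T)%:E; rewrite ?lee_fin //.
      by exists T => //; split=> //; apply/SCE.
    (* Here z is absorbing, and the quantity attached to cycles is +oo. *)
    rewrite -leNgt rho_z => z1; have r1 : r 0%N = 1.
      apply/eqP; rewrite eq_le z1 andbT -rho_z -rho_sum1 (bigD1 ord_max) //=.
      by rewrite ler_wpDr // sumr_ge0.
    by rewrite r1 subrr inve0 mul1e addey // leey.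
  - have [T [sT Tz sgl kT]] := path_attained rho_ge0 rho_sum1 s.
    apply: ge_ereal_inf; exists (kemeny T)%:E; rewrite ?kT //.
    by exists T; rewrite ?kT //; split=> //; apply/SCE.
apply: le_ereal_inf_tmp => _ [T [/SCE[sT Tz] sgl] <-].
have [[s le]|[z1 le]] := kemeny_lower_bound rho_ge0 rho_sum1 sT Tz sgl.
  apply: (@le_trans _ _ (path_value rho s)%:E); last by rewrite lee_fin.
  exact: bigmin_le.
apply: (@le_trans _ _ ((N.+1%:R - 2) / 2 + 1 / (1 - rho ord_max))%:E); last by rewrite lee_fin.
by rewrite -fstE //; apply: bigmin_le_id.
Qed.
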